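(* For every integer $n\ge 0$, monotone partitions of $[n]=\{1,2,\ldots,n\}$ are in one-to-one correspondence with the permutations in $\mathcal{S}_n$ that avoid both $(a\text{-}bc)$ and $(ab\text{-}c)$. Hence $$|\mathcal{S}_n(a\text{-}bc,\,ab\text{-}c)|=|\mathcal{M}_n|,$$ where $\mathcal{M}_n$ is the set of monotone partitions of $[n]$.
   Context: $\mathcal{S}_n$ is the set of permutations of $[n]$, written as words $\pi=a_1a_2\cdots a_n$ (with $\mathcal{S}_0$ consisting of the empty word only). A (generalised) pattern is a word in distinct letters of the ordered alphabet $a<b<c<\cdots$ in which two adjacent letters may or may not be separated by a dash. A $p$-subword of $\pi$ is a subword $a_{i_1}a_{i_2}\cdots a_{i_k}$ ($i_1<i_2<\cdots<i_k$) whose letters are in the same relative order as the letters of $p$, and such that $i_{j+1}=i_j+1$ whenever the $j$th and $(j+1)$st letters of $p$ are not separated by a dash. So an $(a\text{-}bc)$-subword is a subword $a_ia_ja_{j+1}$ with $i<j$ and $a_i<a_j<a_{j+1}$, and an $(ab\text{-}c)$-subword is a subword $a_ia_{i+1}a_j$ with $i+1<j$ and $a_i<a_{i+1}<a_j$. A permutation avoids $p$ if it has no $p$-subword; $\mathcal{S}_n(p,q)$ is the set of permutations in $\mathcal{S}_n$ avoiding both $p$ and $q$. A partition of a set is a family of pairwise disjoint non-empty subsets (blocks) whose union is the set. A partition is monotone if, when its non-singleton blocks $A_1,\ldots,A_k$ are ordered so that $\min A_i>\min A_{i+1}$ for all $i\in[k-1]$, one also has $\max A_i>\max A_{i+1}$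 for all $i\in[k-1]$. *)

(* Defs.v *)
From mathcomp Require Import all_boot all_fingroup.

Set Implicit Arguments.
Unset Strict Implicit.
Unset Printing Implicit Defensive.

(* The letters a < b < c < ... are encoded as 0 < 1 < 2 < ...; the j-th bit
   (counting from 0) of [dashes] tells whether the letters of positions j and
   j+1 are separated by a dash. *)
Record pattern := Pattern {
  letters : seq nat;
  dashes : bitseq;
  letters_uniq : uniq letters;
  size_dashes : size dashes = (size letters).-1 }.

Definition pattern_size (p : pattern) : nat := size (letters p).

Definition a_bc : pattern :=
  @Pattern [:: 0; 1; 2] [:: true; false] isT (erefl 2).

Definition ab_c : pattern :=
  @Pattern [:: 0; 1; 2] [:: false; true] isT (erefl 2).

(* [n] is 'I_n = {0, ..., n-1}, and s : 'S_n is the word (s 0) (s 1) ... (s (n-1)).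
   A subword of s is given by the map i of its positions in s. *)
Definition is_subword (p : pattern) (n : nat) (s : 'S_n)
    (i : {ffun 'I_(pattern_size p) -> 'I_n}) : bool :=
  [forall j : 'I_(pattern_size p), forall k : 'I_(pattern_size p),
    [&& (j < k) ==> (i j < i k),
        (s (i j) < s (i k)) == (nth 0 (letters p) j < nth 0 (letters p) k)
      & (k == j.+1 :> nat) && ~~ nth false (dashes p) j
        ==> (i k == (i j).+1 :> nat)]].

Definition avoids (n : nat) (s : 'S_n) (p : pattern) : bool :=
  ~~ [exists i : {ffun 'I_(pattern_size p) -> 'I_n}, is_subword s i].

Definition avoiders (n : nat) (p q : pattern) : {set 'S_n} :=
  [set s : 'S_n | avoids s p && avoids s q].

(* The unit n exceeds every element of 'I_n, so it never affects the minimum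
   of a nonempty block. *)
Definition block_min (n : nat) (A : {set 'I_n}) : nat :=
  \big[minn/n]_(x in A) x.

Definition block_max (n : nat) (A : {set 'I_n}) : nat := \max_(x in A) x.

(* Blocks of a partition being disjoint and nonempty, their minima are distinct,
   so sorting by >= lists the blocks by strictly decreasing minimum. *)
Definition nonsingleton_blocks (n : nat) (P : {set {set 'I_n}}) :
    seq {set 'I_n} :=
  sort (fun A B => block_min A >= block_min B)
       (enum [set A in P | #|A| != 1]).

Definition is_monotone (n : nat) (P : {set {set 'I_n}}) : bool :=
  sorted (fun A B => block_max A > block_max B) (nonsingleton_blocks P).

Definition monotone_partitions (n : nat) : {set {set {set 'I_n}}} :=
  [set P | partition P [set: 'I_n] && is_monotone P].

(* Main.v *)
Require Import Defs.
From mathcomp Require Import all_boot all_fingroup.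
From mathcomp Require Import zify.

(** Write a partition as a word: inside each block put the minimum first and the
other elements after it in decreasing order, and list the blocks by decreasing
minimum.  Every block then starts at a left-to-right minimum of the word, and
the rest of the block contains no left-to-right minimum, so the partition can be
read off the word: two letters share a block exactly when the prefixes ending at
them have the same minimum ([word_ofK]).

In such a word an ascent can only occur at the first two letters of a
non-singleton block, where it goes from the minimum to the maximum of the block
([word_of_ascent]).  Nothing before the minimum is smaller, hence the word
avoids a-bc.  Conversely, avoiding a-bc says that every ascent starts at a
left-to-right minimum, so that between two left-to-right minima the letters
following the first one decrease ([run_decreasing]), and the word is the one
written from its own partition ([partition_ofK]).  Thus partitions correspond to
the permutations that avoid a-bc.

Under this correspondence, an occurrence of ab-c is a block with minimum a and
maximum b > a, followed by a larger letter c.  Such a letter lies in a block of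
smaller minimum, and this block is not a singleton since c > a.  Avoiding ab-c
therefore says that among non-singleton blocks a smaller minimum forces a
smaller maximum, which is monotonicity ([word_of_avoids_ab_c]).

The word is produced by sorting the letters along an injective numerical key;
comparing positions then amounts to comparing keys. *)

Set Implicit Arguments.
Unset Strict Implicit.
Unset Printing Implicit Defensive.

(** * Three-letter increasing patterns *)

(** Both patterns of the theorem are definitionally instances of this one. *)
Definition pattern012 (d0 d1 : bool) : pattern :=
  @Pattern [:: 0; 1; 2] [:: d0; d1] isT (erefl 2).

Lemma avoids012P (n : nat) (s : 'S_n) (d0 d1 : bool) :
  reflect (forall i j k : 'I_n, i < j -> j < k ->
             (~~ d0 -> j = i.+1 :> nat) -> (~~ d1 -> k = j.+1 :> nat) ->
             s i < s j -> s j < s k -> False)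
          (avoids s (pattern012 d0 d1)).
Proof.
apply: (iffP idP) => [/existsPn av i j k ij jk adj0 adj1 sij sjk | av].
  pose m : {ffun 'I_(pattern_size (pattern012 d0 d1)) -> 'I_n} :=
    [ffun t : 'I_3 => nth i [:: i; j; k] t].
  apply/negP: (av m); rewrite negbK.
  apply/forallP => -[[|[|[|//]]] lt_t]; apply/forallP => -[[|[|[|//]]] lt_u];
    rewrite !ffunE /= ?ltnn ?eqxx //=;
    move: adj0 adj1 ij jk sij sjk; case: d0 {m lt_t lt_u av};
    case: d1 => /= a0 a1; try lia.
apply/existsPn => m; apply/negP => /forallP sub.
pose t0 : 'I_3 := @Ordinal 3 0 isT.
pose t1 : 'I_3 := @Ordinal 3 1 isT.
pose t2 : 'I_3 := @Ordinal 3 2 isT.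
have /and3P[/= lt01 /eqP val01 /implyP adj01] := forallP (sub t0) t1.
have /and3P[/= lt12 /eqP val12 /implyP adj12] := forallP (sub t1) t2.
apply: (av (m t0) (m t1) (m t2)) => //.
  by move=> /adj01/eqP.
by move=> /adj12/eqP.
Qed.

(** * Minima and maxima of blocks *)

Section BlockMinMax.
Variables (n : nat).
Implicit Type A : {set 'I_n}.

Lemma block_min_le A x : x \in A -> block_min A <= x.
Proof.
move=> xA; have := mem_index_enum x; rewrite /block_min.
elim: (index_enum _) => // y s IH; rewrite inE big_cons => /orP[/eqP<-|/IH le_x].
  by rewrite xA geq_minl.
by case: ifP => // _; rewrite geq_min le_x orbT.
Qed.


Lemma block_min_le_n A : block_min A <= n.
Proof.
rewrite /block_min; elim/big_rec: _ => // x y _ le_y.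
by rewrite geq_min le_y orbT.
Qed.

Lemma block_min_mem A x : x \in A -> exists2 y, y \in A & y = block_min A :> nat.
Proof.
move=> xA; case: (arg_minnP (fun y : 'I_n => y : nat) xA) => y yA min_y.
exists y => //; apply/eqP; rewrite eqn_leq block_min_le // andbT.
rewrite /block_min; elim/big_ind: _ => // [|a b]; first exact: ltnW.
by rewrite leq_min => -> ->.
Qed.

Lemma block_max_ge A x : x \in A -> x <= block_max A.
Proof. exact: (@leq_bigmax_cond _ _ (fun y : 'I_n => y : nat)). Qed.

Lemma block_max_mem A x : x \in A -> exists2 y, y \in A & y = block_max A :> nat.
Proof.
move=> xA; have A0 : 0 < #|A| by apply/card_gt0P; exists x.
have [y yA maxE] := eq_bigmax_cond (fun y : 'I_n => y : nat) A0.
by exists y.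
Qed.

Lemma card_neq1 A x y : x \in A -> y \in A -> x != y -> #|A| != 1.
Proof.
move=> xA yA; apply: contraNN => /cards1P[z AE].
by move: xA yA; rewrite AE !inE => /eqP-> /eqP->.
Qed.

End BlockMinMax.

(** * Monotone partitions *)

Section Monotone.
Variables (n : nat) (P : {set {set 'I_n}}).
Hypothesis partP : partition P [set: 'I_n].

Lemma block_neq0 A : A \in P -> A != set0.
Proof. by case/and3P: partP => _ _ n0 AP; apply: contraNneq n0 => <-. Qed.

Lemma block_min_inj A B :
  A \in P -> B \in P -> block_min A = block_min B -> A = B.
Proof.
move=> AP BP eqm; have /and3P[_ /trivIsetP disj _] := partP.
have /set0Pn[x xA] := block_neq0 AP.
have /set0Pn[y yB] := block_neq0 BP.
have [a aA am] := block_min_mem xA; have [b bB bm] := block_min_mem yB.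
have ab : a = b by apply: val_inj; rewrite /= am bm.
apply/eqP/idPn => /(disj _ _ AP BP)/pred0P/(_ a) /=.
by rewrite aA ab bB.
Qed.

(** The sorted list only compares neighbours; by transitivity this compares all
pairs, and distinct blocks have distinct minima. *)
Lemma is_monotoneP :
  reflect (forall A B, A \in P -> B \in P -> #|A| != 1 -> #|B| != 1 ->
             block_min B < block_min A -> block_max B < block_max A)
          (is_monotone P).
Proof.
rewrite /is_monotone; set s := nonsingleton_blocks P.
have mem_s A : (A \in s) = (A \in P) && (#|A| != 1).
  by rewrite mem_sort mem_enum inE.
have uniq_s : uniq s by rewrite sort_uniq enum_uniq.
have min_s : sorted (fun A B : {set 'I_n} => block_min A >= block_min B) s.
  by apply: sort_sorted => A B; apply: leq_total.
apply: (iffP idP) => [max_s A B AP BP A1 B1 ltm | mono].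
  have As : A \in s by rewrite mem_s AP.
  have Bs : B \in s by rewrite mem_s BP.
  have [lt_i | lt_i | eq_i] := ltngtP (index A s) (index B s).
  - apply: (sorted_ltn_index _ max_s A B As Bs lt_i) => X Y Z lt1 lt2.
    exact: ltn_trans lt2 lt1.
  - suff : block_min A <= block_min B by rewrite leqNgt ltm.
    apply: (sorted_ltn_index _ min_s B A Bs As lt_i) => X Y Z le1 le2.
    exact: leq_trans le2 le1.
  - by move: ltm; rewrite -(nth_index A As) eq_i (nth_index A Bs) ltnn.
apply/(sortedP set0) => i lt_i; have lt_i' := ltnW lt_i.
have := mem_nth set0 lt_i; have := mem_nth set0 lt_i'.
rewrite !mem_s => /andP[AP A1] /andP[BP B1]; apply: mono => //.
rewrite ltn_neqAle; apply/andP; split; last by move/(sortedP set0): min_s; apply.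
apply/eqP => /(block_min_inj BP AP)/eqP.
by rewrite nth_uniq // => /eqP; lia.
Qed.

End Monotone.

(** * Sorting letters along an injective key *)

Section SortingPermutation.
Variables (n : nat) (K : 'I_n -> nat).
Hypothesis K_inj : injective K.

Lemma rank_subproof v : #|[set u | K u < K v]| < n.
Proof.
rewrite -[X in _ < X]card_ord -cardsT; apply: proper_card.
by apply/properP; split; [apply/subsetP | exists v; rewrite ?inE ?ltnn].
Qed.

Definition rank v : 'I_n := Ordinal (rank_subproof v).

Lemma ltn_rank u v : K u < K v -> rank u < rank v.
Proof.
move=> ltK; apply: proper_card; apply/properP; split.
  by apply/subsetP => w; rewrite !inE => /ltn_trans; apply.
by exists u; rewrite !inE ?ltnn.
Qed.

Lemma rank_inj : injective rank.
Proof.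
move=> u v eq_r; apply: K_inj.
by have [/ltn_rank|/ltn_rank|] := ltngtP (K u) (K v); rewrite ?eq_r ?ltnn.
Qed.

(** [rank] sends a letter to its position; the word sends a position to its
letter, whence the inverse. *)
Definition sorting_perm : 'S_n := (perm rank_inj)^-1%g.

Lemma sorting_permE i j : (K (sorting_perm i) < K (sorting_perm j)) = (i < j).
Proof.
have rk t : rank (sorting_perm t) = t.
  by rewrite -[LHS](permE rank_inj) /sorting_perm permKV.
rewrite -[in RHS](rk i) -[in RHS](rk j).
have [|gt|/K_inj ->] := ltngtP (K (sorting_perm i)) (K (sorting_perm j)).
- by move/ltn_rank->.
- by have /ltnW := ltn_rank gt; rewrite leqNgt => /negbTE.
- by rewrite ltnn.
Qed.

Lemma sorting_perm_unique (s : 'S_n) :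
  (forall i j : 'I_n, i < j -> K (s i) < K (s j)) -> sorting_perm = s.
Proof.
move=> inc; have Kle i j : (K (s i) < K (s j)) = (i < j).
  apply/idP/idP; last exact: inc.
  apply: contraTT; rewrite -!leqNgt leq_eqVlt => /orP[/eqP/val_inj->//|].
  by move/inc/ltnW.
have rk v : rank (s v) = v.
  apply: val_inj; rewrite /=.
  have -> : [set u | K u < K (s v)] = s @: [set i : 'I_n | i < v].
    apply/setP => u; rewrite -[u](permKV s) (mem_imset _ _ perm_inj) !inE.
    by rewrite Kle.
  rewrite (card_imset _ perm_inj) -sum1dep_card.
  by rewrite -(big_ord_widen n (fun=> 1) (ltnW (ltn_ord v))) sum1_card card_ord.
apply/permP => i; apply: rank_inj; rewrite rk.
by rewrite -[LHS](permE rank_inj) /sorting_perm permKV.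
Qed.

End SortingPermutation.

(** * Partitions and words *)

Lemma ltn_lex N q q' r r' : r < N -> r' < N ->
  (q * N + r < q' * N + r') = (q < q') || (q == q') && (r < r').
Proof.
move=> rN r'N; have [lt_q|lt_q|->] := ltngtP q q'; last by rewrite ltn_add2l.
  by have := leq_mul lt_q (leqnn N); rewrite mulSn; lia.
by have := leq_mul lt_q (leqnn N); rewrite mulSn; lia.
Qed.

Section Words.
Variable n : nat.
Implicit Types (P : {set {set 'I_n}}) (s : 'S_n).

Definition block_of P (v : 'I_n) : nat := block_min (pblock P v).

Lemma position_succ s (a b : 'I_n) : (s^-1)%g a < (s^-1)%g b ->
  (forall x, (s^-1)%g a < (s^-1)%g x -> (s^-1)%g x < (s^-1)%g b -> False) ->
  (s^-1)%g b = ((s^-1)%g a).+1 :> nat.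
Proof.
move=> lt_ab none; apply/eqP; rewrite eqn_leq lt_ab andbT leqNgt; apply/negP => lt_Sab.
have lt_Sa : ((s^-1)%g a).+1 < n by apply: ltn_trans lt_Sab (ltn_ord _).
by apply: (none (s (Ordinal lt_Sa))); rewrite permK /=.
Qed.

(** Encodes the lexicographic order of the word: decreasing block minimum first,
then, inside a block, the minimum before the other letters in decreasing order.
The base n.+1 exceeds the second component, and n - v is never 0, which keeps
the minimum of the block in front. *)
Definition word_key P (v : 'I_n) : nat :=
  (n - block_of P v) * n.+1 + (if v == block_of P v :> nat then 0 else n - v).

Lemma ltn_word_key P u v :
  (word_key P u < word_key P v) =
  (block_of P v < block_of P u)
  || [&& block_of P u == block_of P v, v != block_of P v :> nat
       & (u == block_of P u :> nat) || (v < u)].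
Proof.
have := block_min_le_n (pblock P u); have := block_min_le_n (pblock P v).
rewrite -/(block_of P u) -/(block_of P v).
have := ltn_ord u; have := ltn_ord v => vn un pvn pun.
by rewrite /word_key ltn_lex; case: (eqVneq (u : nat) (block_of P u));
  case: (eqVneq (v : nat) (block_of P v)); lia.
Qed.

(** The key determines [block_of P v], then [v].  Injectivity for arbitrary
families makes [word_of] a total function on families of sets. *)
Lemma word_key_inj P : injective (word_key P).
Proof.
move=> u v eqK; apply: val_inj; move: (ltn_word_key P u v) (ltn_word_key P v u).
by rewrite eqK ltnn => /=; lia.
Qed.

Definition word_of P : 'S_n := sorting_perm (word_key_inj (P := P)).

Lemma word_ofE P i j :
  (word_key P (word_of P i) < word_key P (word_of P j)) = (i < j).
Proof. exact: sorting_permE. Qed.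

Lemma word_of_adjacent P (i j x : 'I_n) : j = i.+1 :> nat ->
  word_key P (word_of P i) < word_key P x ->
  word_key P x < word_key P (word_of P j) -> False.
Proof.
move=> ji; rewrite -[x](permKV (word_of P)) !word_ofE; lia.
Qed.

(** The last left-to-right minimum of [s] at or before the letter [v]. *)
Definition prefix_min s (v : 'I_n) : nat :=
  block_min [set u : 'I_n | (s^-1)%g u <= (s^-1)%g v].

Definition partition_of s : {set {set 'I_n}} :=
  preim_partition (prefix_min s) [set: 'I_n].

Lemma prefix_min_le s u v : (s^-1)%g u <= (s^-1)%g v -> prefix_min s v <= u.
Proof. by move=> le_uv; apply: block_min_le; rewrite inE. Qed.

Lemma prefix_min_anti s u v :
  (s^-1)%g u <= (s^-1)%g v -> prefix_min s v <= prefix_min s u.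
Proof.
move=> le_uv; have uS : u \in [set w : 'I_n | (s^-1)%g w <= (s^-1)%g u] by rewrite inE.
have [m] := block_min_mem uS; rewrite inE -/(prefix_min s u) => le_mu <-.
by apply: prefix_min_le; apply: leq_trans le_uv.
Qed.

Lemma prefix_min_attained s v :
  exists m : 'I_n, [/\ m = prefix_min s v :> nat, (s^-1)%g m <= (s^-1)%g v
                     & prefix_min s m = prefix_min s v].
Proof.
have vS : v \in [set w : 'I_n | (s^-1)%g w <= (s^-1)%g v] by rewrite inE.
have [m] := block_min_mem vS; rewrite inE -/(prefix_min s v) => le_mv mE.
exists m; split=> //; apply/eqP; rewrite eqn_leq (prefix_min_anti le_mv) andbT -mE.
exact: prefix_min_le.
Qed.

Lemma partition_ofP s : partition (partition_of s) [set: 'I_n].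
Proof. exact: preim_partitionP. Qed.

Section BlocksOfPartition.
Variable P : {set {set 'I_n}}.
Hypothesis partP : partition P [set: 'I_n].

Lemma mem_block v : v \in pblock P v.
Proof. by rewrite mem_pblock (cover_partition partP) inE. Qed.

Lemma block_in v : pblock P v \in P.
Proof. by rewrite pblock_mem // (cover_partition partP) inE. Qed.

Lemma block_eq A v : A \in P -> v \in A -> pblock P v = A.
Proof. by apply: def_pblock; case/and3P: partP. Qed.

Lemma block_of_le v : block_of P v <= v.
Proof. exact/block_min_le/mem_block. Qed.

Lemma block_ofP A v : A \in P -> (v \in A) = (block_of P v == block_min A).
Proof.
move=> AP; apply/idP/eqP => [vA | eqm]; first by rewrite /block_of (block_eq AP vA).
by rewrite -(block_min_inj partP (block_in v) AP eqm) mem_block.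
Qed.

Lemma block_of_mem v :
  exists2 m : 'I_n, m = block_of P v :> nat & block_of P m = block_of P v.
Proof.
have [m mA mE] := block_min_mem (mem_block v).
by exists m => //; rewrite /block_of (block_eq (block_in v) mA).
Qed.

(** Letters up to [v] come from blocks of minimum at least that of the block of
[v], and the latter minimum itself occurs no later than [v]. *)
Lemma prefix_min_word_of v : prefix_min (word_of P) v = block_of P v.
Proof.
set s := word_of P.
have le_posE u w : ((s^-1)%g u <= (s^-1)%g w) = (word_key P u <= word_key P w).
  by rewrite leqNgt -(word_ofE P) !permKV -leqNgt.
apply/eqP; rewrite eqn_leq; apply/andP; split.
  have [m mE mbl] := block_of_mem v; rewrite -mE; apply: block_min_le.
  by rewrite inE le_posE leqNgt ltn_word_key mbl -mE eqxx ltnn andbF.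
have vS : v \in [set u : 'I_n | (s^-1)%g u <= (s^-1)%g v] by rewrite inE.
have [u] := block_min_mem vS; rewrite inE le_posE /prefix_min => le_uv <-.
have := block_of_le u; move: le_uv; rewrite leqNgt ltn_word_key; lia.
Qed.

Lemma word_ofK : partition_of (word_of P) = P.
Proof.
rewrite -[RHS](preim_partition_pblock partP).
apply: eq_in_imset => v _; apply/setP => u; rewrite !inE /= !prefix_min_word_of.
apply/eqP/eqP => [|eqP]; last by rewrite /block_of eqP.
exact: (block_min_inj partP (block_in v) (block_in u)).
Qed.

(** Within a block only the step out of the minimum can go up, and it leads to the
maximum of the block; a step to a new block goes down since it reaches the
minimum of that block. *)
Lemma word_of_ascent (i j : 'I_n) : j = i.+1 :> nat ->
  word_of P i < word_of P j ->
  [/\ word_of P i = block_of P (word_of P i) :> nat,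
      block_of P (word_of P i) = block_of P (word_of P j)
    & forall x, block_of P x = block_of P (word_of P i) -> x <= word_of P j].
Proof.
move=> ji; have := word_of_adjacent (P := P) ji; have : i < j by rewrite ji.
rewrite -(word_ofE P); move: (word_of P i) (word_of P j) => b c.
rewrite ltn_word_key => before adj ltbc.
have [m mE mbl] := block_of_mem c.
have := block_of_le b => leb; have := block_of_le c => lec.
have eqbc : block_of P b = block_of P c.
  (* Otherwise the minimum m of the block of c is either c itself, and then
     c < b, or a letter strictly between b and c. *)
  apply/eqP; apply: contraTT before => neq.
  rewrite negb_or negb_and neq andbT -leqNgt leqNgt; apply/negP => lt_bl.
  by case: (adj m); rewrite ltn_word_key; lia.
split=> //; first lia.
move=> x xbl; rewrite leqNgt; apply/negP => ltcx.
by case: (adj x); rewrite ltn_word_key; lia.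
Qed.

(** An ascent starts at the minimum of its block, and all earlier letters come
from blocks with at least that minimum. *)
Lemma word_of_avoids_a_bc : avoids (word_of P) a_bc.
Proof.
apply/(avoids012P _ true false) => i j k ij _ _ /(_ isT) kj lt1 lt2.
have [bE _ _] := word_of_ascent kj lt2.
have := block_of_le (word_of P i).
by move: ij; rewrite -(word_ofE P) ltn_word_key; lia.
Qed.

(** A non-singleton block occupies consecutive positions starting with its minimum
and then its maximum; both implications compare this ascent with the letters of
the later blocks. *)
Lemma word_of_avoids_ab_c : avoids (word_of P) ab_c = is_monotone P.
Proof.
apply/(avoids012P _ false true)/(is_monotoneP partP) => [av A B AP BP A1 B1 ltm | mono].
  have /set0Pn[x xA] := block_neq0 partP AP.
  have /set0Pn[y yB] := block_neq0 partP BP.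
  (* If max B is not below max A, then min A, max A, max B form an ab-c. *)
  have [a aA aE] := block_min_mem xA; have [b bA bE] := block_max_mem xA.
  have [v vB vE] := block_max_mem yB.
  have ab : a != b :> nat.
    apply: contraNneq A1 => eq_ab; apply/cards1P; exists a; apply/setP => z.
    rewrite inE; apply/idP/eqP => [zA | -> //]; apply: val_inj => /=.
    by apply/eqP; rewrite eqn_leq {1}eq_ab bE aE block_max_ge ?block_min_le.
  have [bl_a bl_b bl_v] : [/\ block_of P a = block_min A,
      block_of P b = block_min A & block_of P v = block_min B].
    by split; apply/eqP; rewrite -block_ofP.
  pose w := word_of P.
  have posE u u' : ((w^-1)%g u < (w^-1)%g u') = (word_key P u < word_key P u').
    by rewrite -(word_ofE P) !permKV.
  have le_ab : a <= b by rewrite aE block_min_le.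
  have kab : word_key P a < word_key P b by rewrite ltn_word_key; lia.
  have kbv : word_key P b < word_key P v by rewrite ltn_word_key; lia.
  rewrite -bE -vE ltnNge; apply/negP => le_bv.
  have pos_b : (w^-1)%g b = ((w^-1)%g a).+1 :> nat.
    apply: position_succ => [|z]; rewrite !posE // => kaz kzb.
    have zA : z \in A by move: kaz kzb; rewrite (block_ofP _ AP) !ltn_word_key; lia.
    have := block_max_ge zA; move: kaz kzb; rewrite -bE !ltn_word_key; lia.
  have ltbv : b < v.
    rewrite ltn_neqAle le_bv andbT; apply: contraTneq kbv => /val_inj->.
    by rewrite ltnn.
  by apply: (av ((w^-1)%g a) ((w^-1)%g b) ((w^-1)%g v)); rewrite ?posE ?permKV //; lia.
move=> i j k _ jk /(_ isT) ji _ lt1 lt2.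
have [aE bl_ab bmax] := word_of_ascent ji lt1; move: jk; rewrite -(word_ofE P).
have : word_key P (word_of P i) < word_key P (word_of P j) by rewrite word_ofE ji.
move: (word_of P i) (word_of P j) (word_of P k) aE bl_ab bmax lt1 lt2 => a b c.
rewrite !ltn_word_key => aE bl_ab bmax ltab ltbc kab kbc.
have := block_of_le a; have := block_of_le b; have := block_of_le c => c_ge b_ge a_ge.
(* After b, the block of a only has letters below b. *)
have lt_bl : block_of P c < block_of P a by lia.
have c_n1 : #|pblock P c| != 1.
  have [m mE mbl] := block_of_mem c.
  apply: (card_neq1 (x := m) (y := c)); rewrite ?mem_block //.
    by rewrite (block_ofP _ (block_in c)) mbl.
  by apply: contraTneq ltbc => mc; subst m; lia.
have a_n1 : #|pblock P a| != 1.
  apply: (card_neq1 (x := a) (y := b)); rewrite ?mem_block //.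
    by rewrite (block_ofP _ (block_in a)) -bl_ab.
  by apply: contraTneq ltab => ->; rewrite ltnn.
have := mono _ _ (block_in a) (block_in c) a_n1 c_n1 lt_bl.
have [y yA <-] := block_max_mem (mem_block a).
have := block_max_ge (mem_block c).
by move: yA; rewrite (block_ofP _ (block_in a)) => /eqP/bmax; lia.
Qed.

End BlocksOfPartition.

Lemma block_of_partition_of s v : block_of (partition_of s) v = prefix_min s v.
Proof.
have memE u : (u \in pblock (partition_of s) v) = (prefix_min s v == prefix_min s u).
  rewrite pblock_equivalence_partition ?inE // => x y z _ _ _.
  by split=> // /eqP->.
have vB : v \in pblock (partition_of s) v by rewrite memE.
apply/eqP; rewrite eqn_leq; apply/andP; split.
  have [m [mM _ mE]] := prefix_min_attained s v; rewrite -mM.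
  by apply: block_min_le; rewrite memE mE.
have [m] := block_min_mem vB; rewrite memE => /eqP-> mE.
by rewrite /block_of -mE; apply: prefix_min_le.
Qed.

(** If a step that stays in the same run and starts after the left-to-right
minimum m of that run went up, this ascent together with m would form an a-bc. *)
Lemma run_decreasing s (i j : 'I_n) : avoids s a_bc -> i < j ->
  prefix_min s (s i) = prefix_min s (s j) -> s i != prefix_min s (s i) :> nat ->
  s j < s i.
Proof.
move/(avoids012P _ true false) => av.
have step (k l : 'I_n) : l = k.+1 :> nat ->
    prefix_min s (s k) = prefix_min s (s l) ->
    s k != prefix_min s (s k) :> nat -> s l < s k.
  move=> lk eqm nmin; rewrite ltnNge leq_eqVlt.
  apply/negP => /orP[/eqP/val_inj/perm_inj|lt_s].
    by move=> kl; move: lk; rewrite kl; lia.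
  have [m [mE mk _]] := prefix_min_attained s (s k); rewrite permK in mk.
  have lt_mk : (s^-1)%g m < k.
    rewrite ltn_neqAle mk andbT; apply: contraNneq nmin => /val_inj mk'.
    by rewrite -mE -mk' permKV.
  apply: (av ((s^-1)%g m) k l) => //; first by rewrite lk.
  rewrite permKV ltn_neqAle mE eq_sym nmin; apply: prefix_min_le; exact: leqnn.
move=> ij; have [d jE] : exists d, j = (i + d).+1 :> nat by exists (j - i).-1; lia.
elim: d j jE {ij} => [|d IH] j jE eqm nmin; first by apply: step => //; lia.
have ltj' : j.-1 < n by have := ltn_ord j; lia.
pose j' := Ordinal ltj'.
have eqm' : prefix_min s (s i) = prefix_min s (s j').
  apply/eqP; rewrite eqn_leq; apply/andP; split.
    by rewrite eqm; apply: prefix_min_anti; rewrite !permK /=; lia.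
  by apply: prefix_min_anti; rewrite !permK /=; lia.
have := IH j' _ eqm' nmin; rewrite /= => /(_ ltac:(lia)); apply: ltn_trans.
apply: step; rewrite -?eqm' //=; first lia.
have [m [<- mi _]] := prefix_min_attained s (s i); rewrite permK in mi.
apply: contraTneq mi => /val_inj <-; rewrite permK /=; lia.
Qed.

(** It suffices that the keys increase along [s]: prefix minima do not increase,
and within a run the left-to-right minimum is followed by decreasing letters. *)
Lemma partition_ofK s : avoids s a_bc -> word_of (partition_of s) = s.
Proof.
move=> av; apply: sorting_perm_unique => i j ij.
rewrite ltn_word_key !block_of_partition_of.
have := prefix_min_anti (s := s) (u := s i) (v := s j).
rewrite !permK => /(_ (ltnW ij)); rewrite leq_eqVlt orbC.
case: ltnP => //= _ /eqP eqm; rewrite eqm eqxx /=; apply/andP; split.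
  have [m [mE mi _]] := prefix_min_attained s (s i); rewrite -mE; rewrite permK in mi.
  by apply: contraTneq mi => /val_inj <-; rewrite permK -ltnNge.
by case: eqP => //= /eqP nmin; apply: run_decreasing; rewrite // eqm.
Qed.

End Words.

(** * The bijection *)

Theorem proposition15 (n : nat) :
  (exists f : {set {set 'I_n}} -> 'S_n,
      {in monotone_partitions n &, injective f} /\
      f @: monotone_partitions n = avoiders n a_bc ab_c) /\
  #|avoiders n a_bc ab_c| = #|monotone_partitions n|.
Proof.
have inj : {in monotone_partitions n &, injective (@word_of n)}.
  move=> P Q; rewrite !inE => /andP[partP _] /andP[partQ _] eqPQ.
  by rewrite -(word_ofK partP) eqPQ word_ofK.
have img : @word_of n @: monotone_partitions n = avoiders n a_bc ab_c.
  apply/setP => s; apply/imsetP/idP => [[P] | ].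
    rewrite !inE => /andP[partP monoP] ->.
    by rewrite word_of_avoids_a_bc // word_of_avoids_ab_c.
  rewrite inE => /andP[av1 av2]; exists (partition_of s); last by rewrite partition_ofK.
  by rewrite inE -word_of_avoids_ab_c ?partition_ofK ?partition_ofP.
by split; [exists (@word_of n) | rewrite -img card_in_imset].
Qed.
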